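(* Let $d\ge 2$ and let $\Phi$ be a symmetric linear graph directed Markov system associated to the free group $F_d=\langle g_1,\dots,g_d\rangle$. For every non-trivial normal subgroup $N$ of $F_d$ we have $$\delta(N,\Phi)>\delta(F_d,\Phi)/2.$$
   Context: Let $d\ge2$ and let $F_d=\langle g_1,\dots,g_d\rangle$ be the free group on $g_1,\dots,g_d$. Put $V:=\{g_1,g_1^{-1},\dots,g_d,g_d^{-1}\}$ and $E:=\{(v,w)\in V^2: v\ne w^{-1}\}$. A linear graph directed Markov system (linear GDMS) $\Phi$ associated to $F_d$ consists of nonempty compact sets $X_v\subset\mathbb{R}^D$ ($v\in V$), for some $D\ge1$, and of maps $\phi_{(v,w)}:X_w\to X_v$ ($(v,w)\in E$), each of which is the restriction of a similarity of $\mathbb{R}^D$ with contraction ratio in $(0,1)$, such that: (i) each $X_v$ is connected and equal to the closure of its interior; (ii) (open set condition) for all distinct edges $(v,w)\neq(v',w')$ in $E$, $\phi_{(v,w)}(\mathrm{Int}(X_w))\cap\phi_{(v',w')}(\mathrm{Int}(X_{w'}))=\emptyset$; (iii) (cone property) there exist $l>0$ and $0<\gamma<\pi/2$ such that for each $v\in V$ and $x\in X_v$ there is an open cone with vertex $x$, central angle of measure $\gamma$ and altitude $l$ contained in $\mathrm{Int}(X_v)$; (iv) the contraction ratio of $\phi_{(v,w)}$ is independent of $w$; it is denoted $c_\Phi(v)$. (The remaining conditions in the definition of a conformal GDMS hold automatically for similarities. The edge incidence matrix allows $(v,w)$ to be followed by $(v',w')$ if and only if $w=v'$.) $\Phi$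 is called symmetric if $c_\Phi(g)=c_\Phi(g^{-1})$ for all $g\in V$. Extend $c_\Phi$ to $F_d$ by $c_\Phi(g):=\prod_{i=1}^n c_\Phi(v_i)$, where $v_1\cdots v_n$ is the unique representation of $g$ as a reduced word in elements of $V$ (with $c_\Phi(\mathrm{id})=1$). For a subgroup $H$ of $F_d$, the exponent of convergence is $\delta(H,\Phi):=\inf\{t\ge0:\sum_{h\in H}c_\Phi(h)^t<\infty\}$. *)

(* Defs.v *)
From HB Require Import structures.
From mathcomp Require Import all_boot all_order all_algebra.
From mathcomp Require Import all_classical all_reals all_analysis.
Set Implicit Arguments.
Unset Strict Implicit.
Unset Printing Implicit Defensive.
Import Order.TTheory GRing.Theory Num.Theory.
Import numFieldNormedType.Exports.

Local Open Scope classical_set_scope.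
Local Open Scope ring_scope.

(* (i, true) stands for g_i and (i, false) for g_i^-1 *)
Notation letter d := ('I_d * bool)%type.

Definition letter_inv d (v : letter d) : letter d := (v.1, ~~ v.2).

Definition edge d (v w : letter d) : bool := v != letter_inv w.

Lemma letter_invK d : involutive (@letter_inv d).
Proof. by case=> i b; rewrite /letter_inv /= negbK. Qed.

Lemma edge_inv d (v w : letter d) :
  edge (letter_inv w) (letter_inv v) = edge v w.
Proof. by rewrite /edge letter_invK eq_sym. Qed.

(* two consecutive letters of a reduced word form an edge *)
Definition reduced d (s : seq (letter d)) : bool := sorted (@edge d) s.

(* reduced form of v * s, for s reduced *)
Definition word_cons d (v : letter d) (s : seq (letter d)) : seq (letter d) :=
  if s is w :: s' then if v == letter_inv w then s' else v :: s else [:: v].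

(* reduced form of s * t, for t reduced *)
Definition word_mul d (s t : seq (letter d)) : seq (letter d) :=
  foldr (@word_cons d) t s.

Definition word_inv d (s : seq (letter d)) : seq (letter d) :=
  rev (map (@letter_inv d) s).

Lemma reduced_cons d (v : letter d) s : reduced s -> reduced (word_cons v s).
Proof.
case: s => [//|w s] /= rs; case: ifPn => [_|vw]; first exact: path_sorted rs.
by rewrite /= rs andbT.
Qed.

Lemma reduced_mul d (s t : seq (letter d)) : reduced t -> reduced (word_mul s t).
Proof. by move=> rt; elim: s => //= v s; exact: reduced_cons. Qed.

Lemma reduced_inv d (s : seq (letter d)) : reduced s -> reduced (word_inv s).
Proof.
rewrite /reduced /word_inv rev_sorted sorted_map => rs.
by apply: sub_sorted rs => v w /=; rewrite /relpre /= edge_inv.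
Qed.

Lemma word_consK d (v : letter d) s :
  reduced s -> word_cons v (word_cons (letter_inv v) s) = s.
Proof.
case: s => [|w s] /=; first by rewrite letter_invK eqxx.
rewrite (can_eq (@letter_invK d)) => rs.
have [vw|vw] := eqVneq v w; last by rewrite /= letter_invK eqxx.
case: s rs => [|x s] /=; first by rewrite vw.
by rewrite -vw => /andP[/negPf-> _].
Qed.

Lemma word_mul_cons d (v : letter d) s t : reduced t ->
  word_mul (word_cons v s) t = word_cons v (word_mul s t).
Proof.
case: s => [//|w s] /= rt; case: ifP => // /eqP ->.
by rewrite -{2}(letter_invK w) word_consK //; exact: reduced_mul.
Qed.

Lemma word_mulA d (s t u : seq (letter d)) : reduced u ->
  word_mul s (word_mul t u) = word_mul (word_mul s t) u.
Proof. by move=> ru; elim: s => //= v s ->; rewrite word_mul_cons. Qed.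

Lemma word_mul0 d (s : seq (letter d)) : reduced s -> word_mul s [::] = s.
Proof.
elim: s => // v [//|w s] IH /= /andP[vw rs].
rewrite -[LHS]/(word_cons v (word_mul (w :: s) [::])).
by rewrite IH //= (negPf vw).
Qed.

Lemma word_mulV d (s : seq (letter d)) : word_mul (word_inv s) s = [::].
Proof.
rewrite /word_inv; elim: s => //= v s IH.
by rewrite rev_cons /word_mul foldr_rcons /= eqxx.
Qed.

Lemma word_invK d : involutive (@word_inv d).
Proof.
move=> s; rewrite /word_inv map_rev revK -map_comp map_id_in // => v _.
exact: letter_invK.
Qed.

Record free_group (d : nat) := FreeGroup {
  fg_word :> seq (letter d);
  fg_wordP : reduced fg_word }.

HB.instance Definition _ d := [isSub for @fg_word d].
HB.instance Definition _ d := [Choice of free_group d by <:].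

Definition fg_one d : free_group d := @FreeGroup d [::] isT.
Definition fg_mul d (g h : free_group d) : free_group d :=
  FreeGroup (reduced_mul g (fg_wordP h)).
Definition fg_inv d (g : free_group d) : free_group d :=
  FreeGroup (reduced_inv (fg_wordP g)).

Lemma fg_mulA d : associative (@fg_mul d).
Proof. by move=> g h k; apply/val_inj/word_mulA/fg_wordP. Qed.
Lemma fg_mul1g d : left_id (@fg_one d) (@fg_mul d).
Proof. by move=> g; apply/val_inj. Qed.
Lemma fg_mulg1 d : right_id (@fg_one d) (@fg_mul d).
Proof. by move=> g; apply/val_inj/word_mul0/fg_wordP. Qed.
Lemma fg_mulVg d : left_inverse (@fg_one d) (@fg_inv d) (@fg_mul d).
Proof. by move=> g; apply/val_inj/word_mulV. Qed.
Lemma fg_mulgV d : right_inverse (@fg_one d) (@fg_inv d) (@fg_mul d).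
Proof.
move=> g; apply/val_inj; rewrite /= -{1}(word_invK g); exact: word_mulV.
Qed.

HB.instance Definition _ d := @isGroup.Build (free_group d)
  (@fg_one d) (@fg_inv d) (@fg_mul d)
  (@fg_mulA d) (@fg_mul1g d) (@fg_mulg1 d) (@fg_mulVg d) (@fg_mulgV d).

Definition subgroup (G : groupType) (H : set G) : Prop :=
  group_closed (mem H).

Definition normal_subgroup (G : groupType) (N : set G) : Prop :=
  subgroup N /\ forall x y : G, N x -> N (x ^ y)%g.

(* The library's norm on 'rV[R]_D is the sup norm; it induces the same topology
   as the Euclidean norm, but similarities and cones need the latter. *)
Definition dotmul (R : realType) D (x y : 'rV[R]_D) : R :=
  \sum_(i < D) x 0 i * y 0 i.

Definition enorm (R : realType) D (x : 'rV[R]_D) : R := Num.sqrt (dotmul x x).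

Definition similarity (R : realType) D (r : R) (f : 'rV[R]_D -> 'rV[R]_D) : Prop :=
  forall x y, enorm (f x - f y) = r * enorm (x - y).

(* Vertex x, unit axis u, opening angle gamma (so the angle between the axis and
   the lateral surface is gamma / 2), altitude l. *)
Definition open_cone (R : realType) D (x u : 'rV[R]_D) (gamma l : R) :
    set 'rV[R]_D :=
  [set y | enorm (y - x) * cos (gamma / 2) < dotmul (y - x) u < l].

(* The maps are given as similarities of the whole space; only their values on
   the sets X_w, and only for edges (v, w), are constrained. *)
Record linear_gdms (R : realType) (d : nat) := LinearGDMS {
  gdms_dim : nat;
  gdms_dim_gt0 : (0 < gdms_dim)%N;
  gdms_set : letter d -> set 'rV[R]_gdms_dim;
  gdms_map : letter d -> letter d -> 'rV[R]_gdms_dim -> 'rV[R]_gdms_dim;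
  gdms_ratio : letter d -> R;
  gdms_set_nonempty : forall v, gdms_set v !=set0;
  gdms_set_compact : forall v, compact (gdms_set v);
  gdms_set_connected : forall v, connected (gdms_set v);
  gdms_set_regular : forall v, gdms_set v = closure (interior (gdms_set v));
  gdms_ratio_itv : forall v, 0 < gdms_ratio v < 1;
  (* the ratio of the map of the edge (v, w) depends on v only *)
  gdms_similarity : forall v w, edge v w ->
    similarity (gdms_ratio v) (gdms_map v w);
  gdms_map_sub : forall v w, edge v w ->
    gdms_map v w @` gdms_set w `<=` gdms_set v;
  gdms_open_set_condition : forall v w v' w', edge v w -> edge v' w' ->
    (v, w) != (v', w') ->
    gdms_map v w @` interior (gdms_set w)
      `&` gdms_map v' w' @` interior (gdms_set w') = set0;
  gdms_cone_property : exists l gamma : R,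
    [/\ 0 < l, 0 < gamma < pi / 2 &
      forall v x, gdms_set v x -> exists2 u, enorm u = 1 &
        open_cone x u gamma l `<=` interior (gdms_set v)] }.

Definition symmetric_gdms (R : realType) d (Phi : linear_gdms R d) : Prop :=
  forall v, gdms_ratio Phi v = gdms_ratio Phi (letter_inv v).

Definition word_ratio (R : realType) d (Phi : linear_gdms R d)
    (g : free_group d) : R :=
  \prod_(v <- fg_word g) gdms_ratio Phi v.

(* extended real: the infimum of the empty set is +oo *)
Definition exponent_of_convergence (R : realType) d (H : set (free_group d))
    (Phi : linear_gdms R d) : \bar R :=
  ereal_inf [set t%:E | t in [set t : R | 0 <= t /\
    (\esum_(h in H) (word_ratio Phi h `^ t)%:E < +oo)%E]].

(* Main.v *)
Require Import Defs.
From mathcomp Require Import all_boot all_order all_algebra.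
From mathcomp Require Import all_classical all_reals all_analysis.
From mathcomp Require Import ring lra.
Set Implicit Arguments.
Unset Strict Implicit.
Unset Printing Implicit Defensive.
Import Order.TTheory GRing.Theory Num.Theory.
Import numFieldNormedType.Exports.

(** The contraction ratios form a symmetric weight on the letters with values in
    (0, 1).  Let c be the induced weight on reduced words and D the exponent of
    the whole free group.

    Conjugates alone give the weak inequality: if [h] is a non-trivial element
    of N and the word g h g^-1 is reduced, its weight is c(g)^2 c(h), so the
    series of N at D/2 dominates a multiple of the series of the whole group
    at D, which diverges.  To gain strictness, products of such conjugates are
    used.  A finite set of words no one of which is a prefix of another (a
    prefix code) and which may be freely concatenated has k-fold
    concatenations that are pairwise distinct for fixed k; if its weights to
    the power t add up to q > 1, the concatenations contribute q^k for every
    k, and the series diverges at t ([code_series_eqy]).  The inequality q > 1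
    at t = D/2 persists for some t > D/2 because q is a finite sum depending
    continuously on t.  So it suffices to find a prefix code made of the words
    g h g^-1 h whose total weight at D/2, which is c(h)^D times the sum of the
    c(g)^D, exceeds 1.

    At the exponent D, the total weight of the reduced words of length n stays
    between two positive constants ([critical_exponent]).  Each word length
    thus offers a fixed amount of weight, and the sum of the c(g)^D can be made
    as large as desired by using many lengths.  The prefix condition is
    obtained by letting the lengths grow so fast that a shorter code word can
    only be a prefix of a longer conjugator g', and by discarding such g'.
    The discarded weight is small: the words beginning with g h g^-1 h have
    total weight at most a constant times c(g)^(2D), and the square makes the
    sum over the long words g small ([sparse_conj_code]). *)

Local Open Scope classical_set_scope.
Local Open Scope ring_scope.

(** * Reduced words *)

(** This separates the inner condition on a block of a concatenation from the
    condition at its left end; [y] is a default value. *)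
Lemma path_reduced d (x y : letter d) s :
  path (@edge d) x s = reduced s && ((s == [::]) || edge x (head y s)).
Proof. by case: s => [|z s] //=; rewrite andbC. Qed.

Lemma reduced_cat d (s t : seq (letter d)) :
  reduced (s ++ t) -> reduced s && reduced t.
Proof. by rewrite /reduced => /cat_sorted2[-> ->]. Qed.

Lemma word_mul_cat d (s t : seq (letter d)) :
  reduced (s ++ t) -> word_mul s t = s ++ t.
Proof.
elim: s => //= v s IH rvst; rewrite /word_mul /= -/(word_mul s t) IH; last first.
  by rewrite /reduced /= in rvst; exact: path_sorted rvst.
by case: (s ++ t) rvst => //= w u /andP[/negPf ->].
Qed.

Lemma edge_self d (v : letter d) : edge v v.
Proof. by case: v => i b; rewrite /edge /letter_inv xpair_eqE eqxx /=; case: b. Qed.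

Lemma exists_letter_notin d (p q : letter d) : (2 <= d)%N ->
  exists x : letter d, (x != p) && (x != q).
Proof.
move=> hd; apply/existsP; apply: contraLR hd => /existsPn H; rewrite -ltnNge.
have: (#|{: letter d}| <= #|pred2 p q|)%N.
  apply/subset_leq_card/fintype.subsetP => x _; have := H x.
  by rewrite !inE negb_and !negbK.
rewrite card_prod card_ord card_bool card2 => h.
have {h} : (d * 2 <= 2)%N by apply: leq_trans h _; case: eqP.
by case: d {p q H} => [|[|d]].
Qed.

(** With at least four letters, any two reduced words can be joined into a
    reduced word by one intermediate letter. *)
Lemma connecting_letter d (x y : letter d) : (2 <= d)%N ->
  exists v, edge x v && edge v y.
Proof.
move=> hd; have [v /andP[vx vy]] :=
  exists_letter_notin (letter_inv x) (letter_inv y) hd.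
exists v; rewrite /edge vy andbT; apply: contra vx => /eqP ->.
by rewrite letter_invK.
Qed.

Definition words d n : seq (seq (letter d)) :=
  [seq w <- [seq val t | t <- enum {: n.-tuple (letter d)}] | reduced w].

Lemma mem_words d n w : (w \in words d n) = (size w == n) && reduced w.
Proof.
rewrite mem_filter andbC; congr (_ && _); apply/mapP/eqP => [[t _ ->]|wn].
  exact: size_tuple.
by case: n / wn; exists (in_tuple w); rewrite ?mem_enum.
Qed.

Lemma words_uniq d n : uniq (words d n).
Proof. by rewrite filter_uniq// map_inj_uniq ?enum_uniq//; exact: val_inj. Qed.

(** * Weights of finite families of words *)

Section Weight.
Variables (R : realType) (d : nat).
Implicit Types (f : letter d -> R) (w : seq (letter d)) (L : seq (seq (letter d))).

Definition weight f w : R := \prod_(v <- w) f v.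

Definition mass f L : R := \sum_(w <- L) weight f w.

Lemma weight_cat f s t : weight f (s ++ t) = weight f s * weight f t.
Proof. exact: big_cat. Qed.

Lemma weight_gt0 f w : (forall v, 0 < f v) -> 0 < weight f w.
Proof. by move=> f0; apply: prodr_gt0. Qed.

Lemma weight_le1 f w : (forall v, 0 < f v <= 1) -> weight f w <= 1.
Proof. 
move=> f0; elim: w => [|v w IH]; first by rewrite /weight big_nil.
rewrite /weight big_cons -/(weight f w) mulr_ile1 //.
- by case/andP: (f0 v) => /ltW.
- by apply/ltW/weight_gt0 => u; case/andP: (f0 u).
- by case/andP: (f0 v).
Qed.

Lemma weight_inv f w : (forall v, f v = f (letter_inv v)) ->
  weight f (word_inv w) = weight f w.
Proof.
move=> fs; rewrite /weight /word_inv (perm_big _ (permEl (perm_rev _))) big_map.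
by apply: eq_bigr => v _; rewrite -fs.
Qed.

Lemma weight_le_exp f rho w : (forall v, 0 < f v <= rho) ->
  weight f w <= rho ^+ size w.
Proof.
move=> f0; elim: w => [|v w IH]; first by rewrite /weight big_nil.
rewrite /weight big_cons -/(weight f w) exprS ler_pM //.
- by case/andP: (f0 v) => /ltW.
- by apply/ltW/weight_gt0 => u; case/andP: (f0 u).
- by case/andP: (f0 v).
Qed.

Lemma mass_ge0 f L : (forall v, 0 < f v) -> 0 <= mass f L.
Proof. by move=> f0; apply: sumr_ge0 => w _; apply/ltW/weight_gt0. Qed.

Lemma mass_cat f L W : mass f (L ++ W) = mass f L + mass f W.
Proof. exact: big_cat. Qed.

Lemma mass_filter f (p : pred (seq (letter d))) L :
  mass f L = mass f [seq w <- L | p w] + mass f [seq w <- L | ~~ p w].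
Proof. by rewrite /mass (bigID p) !big_filter. Qed.

Lemma mass_allpairs f L W :
  mass f [seq s ++ t | s <- L, t <- W] = mass f L * mass f W.
Proof.
rewrite /mass big_allpairs_dep mulr_suml; apply: eq_bigr => s _.
by rewrite mulr_sumr; apply: eq_bigr => t _; rewrite weight_cat.
Qed.

Lemma mass_le_subset f L W : (forall v, 0 < f v) ->
  uniq L -> {subset L <= W} -> mass f L <= mass f W.
Proof.
move=> f0; elim: L W => [|w L IH] W.
  by rewrite /mass big_nil => _ _; exact: mass_ge0.
case/andP=> wL uL sub; have wW : w \in W by apply: sub; rewrite mem_head.
rewrite /mass big_cons (big_rem _ wW) /= lerD2l IH// => u uL'.
apply: rem_mem; last by apply: sub; rewrite inE uL' orbT.
by apply: contraNneq wL => <-.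
Qed.

Definition level f n : R := mass f (words d n).

(** Cutting a reduced word yields two reduced words. *)
Lemma level_submul f m n : (forall v, 0 < f v) ->
  level f (m + n) <= level f m * level f n.
Proof.
move=> f0; rewrite /level -mass_allpairs mass_le_subset ?words_uniq// => w.
rewrite mem_words => /andP[/eqP wmn rw].
apply/allpairsP; exists (take m w, drop m w); rewrite /= cat_take_drop.
move: rw; rewrite -{1}(cat_take_drop m w) => /reduced_cat/andP[rt rd].
by rewrite !mem_words rt rd size_drop size_takel wmn ?leq_addr// addKn !eqxx.
Qed.

End Weight.
(** For an empty word both conditions hold by default, so this is only
    meaningful for [0 < n]. *)
Definition loops d (a : letter d) n : seq (seq (letter d)) :=
  [seq w <- words d n | (head a w == a) && (last a w == a)].

Lemma loops_uniq d (a : letter d) n : uniq (loops a n).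
Proof. exact/filter_uniq/words_uniq. Qed.

Lemma mem_loopsP d (a : letter d) n w : (0 < n)%N -> w \in loops a n ->
  [/\ size w = n, reduced w & exists2 s, w = a :: s & last a s = a].
Proof.
move=> n0; rewrite mem_filter mem_words.
case/andP=> /andP[/eqP wa /eqP la] /andP[/eqP sw rw]; split=> //.
case: w wa la sw {rw} => [|v s] /=; first by move=> _ _ n0'; rewrite -n0' in n0.
by move=> ->; exists s.
Qed.

(** A word u becomes a loop a x u y a for suitable connecting letters x and y.
    So up to a constant factor there is as much weight in the loops, which
    can be freely concatenated, as in all reduced words. *)
Lemma level_le_loops (R : realType) d (f : letter d -> R) (k : R) a n :
  (2 <= d)%N -> 0 < k -> (forall v, k <= f v) ->
  k ^+ 4 * level f n <= mass f (loops a (n + 4)).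
Proof.
move=> hd k0 kf; have f0 v : 0 < f v by exact: lt_le_trans (kf v).
pose x u := xchoose (connecting_letter a (head a u) hd).
pose y u := xchoose (connecting_letter (last (x u) u) a hd).
pose F u := a :: x u :: u ++ [:: y u; a].
have Fle u : k ^+ 4 * weight f u <= weight f (F u).
  rewrite /F /weight !big_cons big_cat /= !big_cons big_nil mulr1 -/(weight f u).
  rewrite [leLHS](_ : _ = k * (k * (weight f u * (k * k)))); last first.
    by ring.
  have w0 := ltW (weight_gt0 u f0); have k0' := ltW k0.
  by do 2![apply: ler_pM; rewrite ?mulr_ge0//]; apply: ler_pM; rewrite ?mulr_ge0// ler_pM.
have: mass f [seq F u | u <- words d n] <= mass f (loops a (n + 4)).
  apply: mass_le_subset => //.
    rewrite map_inj_in_uniq ?words_uniq// => u u'; rewrite !mem_words.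
    move=> /andP[/eqP su _] /andP[/eqP su' _] [_ /eqP].
    by rewrite eqseq_cat ?su// => /andP[/eqP].
  move=> _ /mapP[u + ->]; rewrite mem_words => /andP[/eqP su ru].
  rewrite mem_filter mem_words /F /= last_cat /= size_cat /= su addn2 addn4 !eqxx/=.
  rewrite cat_path /=.
  have /andP[-> xu] := xchooseP (connecting_letter a (head a u) hd).
  have /andP[-> ->] := xchooseP (connecting_letter (last (x u) u) a hd).
  by rewrite (path_reduced _ a) ru xu orbT.
apply: le_trans; rewrite /mass big_map /level /mass mulr_sumr.
by apply: ler_sum => u _; exact: Fle.
Qed.

(** * Prefix codes *)

Definition prefix_code (T : eqType) (S : seq (seq T)) : Prop :=
  {in S &, forall u v, prefix u v -> u = v}.

Definition code_messages (T : Type) (S : seq (seq T)) (k : nat) : seq (seq T) :=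
  iter k (fun M => [seq u ++ s | u <- S, s <- M]) [:: [::]].

(** Unique decoding: of two first code words of the same message one is a
    prefix of the other, so they agree and can be stripped. *)
Lemma code_messages_uniq (T : eqType) (S : seq (seq T)) k :
  uniq S -> prefix_code S -> uniq (code_messages S k).
Proof.
move=> uS pS; elim: k => //= k IH; apply: allpairs_uniq => // -[u' s'] [v' t'].
move=> /allpairsP[[u s] [/= uS' _ [-> ->]]] /allpairsP[[v t] [/= vS _ [-> ->]]] est.
have prefix_le (a b x y : seq T) :
    a ++ x = b ++ y -> (size a <= size b)%N -> prefix a b.
  by move=> eab le; rewrite prefixE -(takel_cat y le) -eab take_size_cat.
have euv : u = v.
  have [le|/ltnW le] := leqP (size u) (size v).
    by apply: pS => //; exact: prefix_le est le.
  by apply/esym/pS => //; exact: prefix_le (esym est) le.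
by move/eqP: est; rewrite euv eqseq_cat// eqxx => /eqP ->.
Qed.

Lemma mass_code_messages (R : realType) d (f : letter d -> R) S k :
  mass f (code_messages S k) = mass f S ^+ k.
Proof.
elim: k => [|k IH]; first by rewrite /mass big_seq1 /weight big_nil.
by rewrite exprS -IH -mass_allpairs.
Qed.

(** By submultiplicativity, shifting the partial sum by n multiplies it by at
    most [level f n], which bounds it as for a geometric series. *)
Lemma levels_bounded (R : realType) d (f : letter d -> R) n M :
  (forall v, 0 < f v) -> level f n < 1 ->
  \sum_(0 <= m < M) level f m <= (\sum_(0 <= m < n) level f m) / (1 - level f n).
Proof.
move=> f0 ln; rewrite ler_pdivlMr ?subr_gt0// mulrBr mulr1 lerBlDr.
have l0 m : 0 <= level f m by apply: mass_ge0.
apply: (@le_trans _ _ (\sum_(0 <= m < n + M) level f m)).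
  by rewrite addnC (@big_cat_nat _ _ _ M 0 (M + n)) ?leq_addr//= lerDl sumr_ge0.
rewrite (@big_cat_nat _ _ _ n 0 (n + M)) ?leq_addr//= lerD2l.
rewrite -{1}[n]add0n big_addn addKn mulr_suml ler_sum// => m _.
by rewrite level_submul.
Qed.
(** * The series of a set of group elements *)

Definition letter_pow (R : realType) d (Phi : linear_gdms R d) (t : R)
  (v : letter d) : R := gdms_ratio Phi v `^ t.

Definition series_at (R : realType) d (Phi : linear_gdms R d)
    (H : set (free_group d)) (t : R) : \bar R :=
  (\esum_(h in H) (word_ratio Phi h `^ t)%:E)%E.

Lemma letter_pow_gt0 (R : realType) d (Phi : linear_gdms R d) t v :
  0 < letter_pow Phi t v.
Proof. by rewrite powR_gt0//; case/andP: (gdms_ratio_itv Phi v). Qed.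

Lemma letter_pow_lt1 (R : realType) d (Phi : linear_gdms R d) t v :
  0 < t -> letter_pow Phi t v < 1.
Proof.
move=> t0; have /andP[c0 c1] := gdms_ratio_itv Phi v.
have := @gt0_ltr_powR R t t0 (gdms_ratio Phi v) 1.
by rewrite powR1 !nnegrE ler01 ltW//; exact.
Qed.

Lemma weight_letter_pow (R : realType) d (Phi : linear_gdms R d) t
    (h : free_group d) :
  word_ratio Phi h `^ t = weight (letter_pow Phi t) h.
Proof.
rewrite /word_ratio /weight; elim: (fg_word h) => [|v w IH].
  by rewrite !big_nil powR1.
have c0 u : 0 <= gdms_ratio Phi u by case/andP: (gdms_ratio_itv Phi u) => /ltW.
by rewrite !big_cons powRM ?IH// prodr_ge0.
Qed.

Lemma mass_letter_pow_continuous (R : realType) d (Phi : linear_gdms R d) L :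
  continuous (fun t : R => mass (letter_pow Phi t) L).
Proof.
move=> t; rewrite /mass /weight; apply: cvg_big => [|w _].
  exact: add_continuous.
apply: cvg_big => [|v _]; first exact: mul_continuous.
have /andP[c0 _] := gdms_ratio_itv Phi v.
rewrite /letter_pow /powR gt_eqF//.
apply: continuous_comp; last exact: continuous_expR.
by apply: cvgMr_tmp.
Qed.

Lemma series_at_ge_mass (R : realType) d (Phi : linear_gdms R d) H t L :
  uniq L -> (forall w, w \in L -> exists2 h, H h & fg_word h = w) ->
  ((mass (letter_pow Phi t) L)%:E <= series_at Phi H t)%E.
Proof.
move=> uL LH; pose F w : free_group d := insubd (fg_one d) w.
have FE w : w \in L -> H (F w) /\ fg_word (F w) = w.
  by move=> /LH[h Hh <-]; rewrite /F (valKd _ h).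
apply: esum_ge; exists [set` [seq F w | w <- L]].
  split; first exact: finite_seq.
  by move=> _ /mapP[w /FE[HF _] ->].
rewrite -fsbig_seq; last first.
  by rewrite map_inj_in_uniq// => u v /FE[_ {2}<-] /FE[_ {2}<-] ->.
rewrite sumEFin lee_fin big_map /mass !big_seq ler_sum// => w /FE[_ Fw].
by rewrite weight_letter_pow Fw.
Qed.

Lemma series_at_le (R : realType) d (Phi : linear_gdms R d) t B :
  (forall M, \sum_(0 <= m < M) level (letter_pow Phi t) m <= B) ->
  (series_at Phi setT t <= B%:E)%E.
Proof.
move=> lB; apply: ge_ereal_sup => _ [X [finX _] <-].
rewrite fsbig_finite// sumEFin lee_fin.
set L := finmap.enum_fset _; have uL : uniq L by exact: finmap.fset_uniq.
pose M := (\max_(h <- L) size (fg_word h)).+1.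
apply: le_trans (lB M).
have -> : \sum_(0 <= m < M) level (letter_pow Phi t) m =
    mass (letter_pow Phi t) (flatten [seq words d m | m <- index_iota 0 M]).
  by rewrite /mass big_flatten big_map.
have -> : \sum_(h <- L) word_ratio Phi h `^ t =
    mass (letter_pow Phi t) [seq fg_word h | h <- L].
  by rewrite /mass big_map; apply: eq_bigr => h _; exact: weight_letter_pow.
apply: mass_le_subset.
- by move=> v; exact: letter_pow_gt0.
- by rewrite map_inj_uniq//; exact: val_inj.
- move=> _ /mapP[h hL ->]; apply/flatten_mapP; exists (size (fg_word h)).
    by rewrite mem_index_iota /= ltnS; exact: leq_bigmax_seq.
  by rewrite mem_words eqxx fg_wordP.
Qed.

Lemma series_at_lty (R : realType) d (Phi : linear_gdms R d) t n :
  level (letter_pow Phi t) n < 1 -> (series_at Phi setT t < +oo)%E.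
Proof.
move=> ln; apply: le_lt_trans (ltry _); apply: series_at_le => M.
by apply: levels_bounded ln => v; exact: letter_pow_gt0.
Qed.

(** The predicate [A] expresses that a word spells an element of [H] and may be
    preceded by any code word. *)
Lemma code_series_eqy (R : realType) d (Phi : linear_gdms R d) H t S
    (A : seq (letter d) -> Prop) :
  uniq S -> prefix_code S -> 1 < mass (letter_pow Phi t) S ->
  A [::] -> (forall u s, u \in S -> A s -> A (u ++ s)) ->
  (forall s, A s -> exists2 h, H h & fg_word h = s) ->
  series_at Phi H t = +oo%E.
Proof.
move=> uS pS q1 A0 AS AH; set q := mass _ _ in q1.
have AM k s : s \in code_messages S k -> A s.
  elim: k s => [|k IH] s; first by rewrite inE => /eqP ->.
  by move=> /allpairsP[[u w] [/= uS' /IH Aw ->]]; exact: AS.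
have le k : ((q ^+ k)%:E <= series_at Phi H t)%E.
  rewrite -mass_code_messages; apply: series_at_ge_mass => [|s /AM/AH//].
  exact: code_messages_uniq.
(* Bernoulli's inequality *)
have qk k : 1 + (q - 1) * k%:R <= q ^+ k.
  elim: k => [|k IH]; first by rewrite mulr0 addr0.
  have k0 : 0 <= k%:R :> R by [].
  have q0 : 0 <= q by lra.
  have qIH := ler_wpM2l q0 IH; have sq : 0 <= (q - 1) * (q - 1) * k%:R.
    by rewrite mulr_ge0// mulr_ge0; lra.
  rewrite exprS -natr1; move: (q ^+ k) (k%:R : R) qIH sq k0 => x y; clear; nra.
apply/eqyP => r r0; pose k := (Num.truncn (r / (q - 1))).+1.
apply: le_trans (le k); rewrite lee_fin; apply: le_trans (qk k).
have q0 : 0 < q - 1 by lra.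
have : r / (q - 1) < k%:R by exact: truncnS_gt.
by rewrite ltr_pdivrMr//; lra.
Qed.

Lemma exponent_le (R : realType) d (Phi : linear_gdms R d) H t :
  0 <= t -> (series_at Phi H t < +oo)%E ->
  (exponent_of_convergence H Phi <= t%:E)%E.
Proof. by move=> t0 fin; apply: ereal_inf_lbound; exists t. Qed.

Lemma exponent_ge (R : realType) d (Phi : linear_gdms R d) H t :
  series_at Phi H t = +oo%E -> (t%:E <= exponent_of_convergence H Phi)%E.
Proof.
move=> eqy; apply/ereal_infP => _ [s [s0 fin] <-]; rewrite lee_fin leNgt.
apply/negP => st; suff: (series_at Phi H t < +oo)%E by rewrite eqy ltxx.
apply: le_lt_trans fin; apply: le_esum => h _; rewrite lee_fin.
have c01 v := gdms_ratio_itv Phi v.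
apply: ger_powR; last exact: ltW.
rewrite weight_gt0 => [|v]; last by case/andP: (c01 v).
by apply: weight_le1 => v; case/andP: (c01 v) => -> /ltW ->.
Qed.
(** * The critical exponent of the free group *)

Lemma mass_gt1_right (R : realType) d (Phi : linear_gdms R d) s L :
  1 < mass (letter_pow Phi s) L ->
  exists2 t, s < t & 1 < mass (letter_pow Phi t) L.
Proof.
move=> /(cvgr_gt _ (@mass_letter_pow_continuous R d Phi L s)).
move=> /nbhs_ballP[e /= e0 sub]; exists (s + e / 2); first by lra.
by apply: sub; rewrite /ball /= opprD addNKr normrN gtr0_norm; lra.
Qed.

Lemma mass_lt1_left (R : realType) d (Phi : linear_gdms R d) s L :
  0 < s -> mass (letter_pow Phi s) L < 1 ->
  exists2 t, 0 <= t < s & mass (letter_pow Phi t) L < 1.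
Proof.
move=> s0 /(cvgr_lt _ (@mass_letter_pow_continuous R d Phi L s)).
move=> /nbhs_ballP[e /= e0 sub]; exists (Num.max 0 (s - e / 2)).
  by rewrite le_max lexx /= gt_max s0/=; lra.
apply: sub; rewrite /ball /=; case: (leP 0 (s - e / 2)) => [h|h].
  by rewrite opprB addrC subrK gtr0_norm; lra.
by rewrite subr0 gtr0_norm; lra.
Qed.

(** The loops of length n form a prefix code.  If their total weight exceeded 1
    at D it would still do so slightly to the right of D, where the series
    would diverge. *)
Lemma loops_mass_le1 (R : realType) d (Phi : linear_gdms R d) D a n :
  exponent_of_convergence setT Phi = D%:E -> (0 < n)%N ->
  mass (letter_pow Phi D) (loops a n) <= 1.
Proof.
move=> expD n0; rewrite leNgt; apply/negP => /mass_gt1_right[t Dt gt1].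
have : series_at Phi setT t = +oo%E.
  apply: (@code_series_eqy _ _ _ _ _ _ (fun s => path (@edge d) a s)
    (loops_uniq a n) _ gt1) => //.
  - move=> u v /(mem_loopsP n0)[su _ _] /(mem_loopsP n0)[sv _ _].
    by rewrite prefixE su -sv take_size => /eqP ->.
  - move=> u s /(mem_loopsP n0)[_ ru [u' eu la]] ps.
    rewrite cat_path (path_reduced _ a) ru eu /= edge_self /= la; exact: ps.
  - by move=> s ps; exists (FreeGroup (path_sorted ps)).
by move=> /exponent_ge; rewrite expD lee_fin leNgt Dt.
Qed.

Lemma level_critical_le (R : realType) d (Phi : linear_gdms R d) D k n :
  (2 <= d)%N -> exponent_of_convergence setT Phi = D%:E ->
  0 < k -> (forall v, k <= letter_pow Phi D v) ->
  level (letter_pow Phi D) n <= (k ^+ 4)^-1.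
Proof.
move=> hd expD k0 kf; pose a : letter d := (Ordinal (ltnW hd), true).
rewrite -[leRHS]mul1r ler_pdivlMr ?exprn_gt0// mulrC.
apply: le_trans (level_le_loops a n hd k0 kf) _.
by apply: loops_mass_le1 => //; rewrite addn4.
Qed.

(** The letters alone have total weight less than 1 at a large exponent, where
    the series therefore converges. *)
Lemma exponent_setT_lty (R : realType) d (Phi : linear_gdms R d) :
  (0 < d)%N -> (exponent_of_convergence setT Phi < +oo)%E.
Proof.
move=> hd; pose a : letter d := (Ordinal hd, true).
have [r r1 rmax] : exists2 r, 0 < r < 1 & forall v, gdms_ratio Phi v <= r.
  have [v _ vmax] := @Order.TotalTheory.arg_maxP _ R _ a xpredT (gdms_ratio Phi) isT.
  by exists (gdms_ratio Phi v) => [|u]; [exact: gdms_ratio_itv|exact: vmax].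
have := @cvg_expr R r; rewrite gtr0_norm; last by case/andP: r1.
case/andP: r1 => r0 r1 /(_ r1)/cvgr_lt/(_ ((size (words d 1))%:R + 1)^-1).
rewrite invr_gt0 => /(_ ltac:(rewrite ltr_wpDl//))[n _ /(_ n (leqnn n))/= rn].
apply: (@le_lt_trans _ _ (n%:R)%:E); last exact: ltry.
apply: exponent_le => //; apply: (@series_at_lty _ _ _ _ 1).
have N0 : 0 < (size (words d 1))%:R + 1 :> R by rewrite ltr_wpDl.
apply: (@le_lt_trans _ _ (\sum_(w <- words d 1) r ^+ n)).
  rewrite /level /mass !big_seq ler_sum// => w; rewrite mem_words.
  case/andP => /eqP sw _; rewrite -[leRHS]expr1 -sw; apply: weight_le_exp => v.
  rewrite letter_pow_gt0 /letter_pow powR_mulrn.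
    by rewrite lerXn2r// ?nnegrE ?ltW//; case/andP: (gdms_ratio_itv Phi v).
  by apply/ltW; case/andP: (gdms_ratio_itv Phi v).
rewrite big_const_seq count_predT iter_addr_0 -mulr_natl.
move: rn; rewrite -[X in X < _]mul1r -[X in _ < X]mul1r ltr_pdivlMr// mul1r.
have := exprn_gt0 n r0; move: (r ^+ n) => x x0; lra.
Qed.

(** The lower bound 1 holds because a level of weight less than 1 at D would
    keep this property slightly to the left of D, where the series would then
    converge.  The exponent 0 is excluded because there the upper bound on the
    levels is 1, whereas the level 1 has several words of weight 1. *)
Lemma critical_exponent (R : realType) d (Phi : linear_gdms R d) :
  (2 <= d)%N -> exists D C, [/\ 0 < D,
    exponent_of_convergence setT Phi = D%:E,
    forall n, 1 <= level (letter_pow Phi D) n &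
    forall n, level (letter_pow Phi D) n <= C].
Proof.
move=> hd; pose a : letter d := (Ordinal (ltnW hd), true).
have exp0 : (0 <= exponent_of_convergence setT Phi)%E.
  by apply/ereal_infP => _ [t [t0 _] <-]; rewrite lee_fin.
pose D := fine (exponent_of_convergence setT Phi).
have expD : exponent_of_convergence setT Phi = D%:E.
  by rewrite fineK// ge0_fin_numE// exponent_setT_lty// ltnW.
have [k k0 kf] : exists2 k, 0 < k & forall v, k <= letter_pow Phi D v.
  have [v _ vmin] :=
    @Order.TotalTheory.arg_minP _ R _ a xpredT (letter_pow Phi D) isT.
  by exists (letter_pow Phi D v) => [|u]; [exact: letter_pow_gt0|exact: vmin].
have D0 : 0 < D.
  (* at D = 0 all the weights are 1, so [k = 1] is a lower bound for them *)
  rewrite lt_neqAle -lee_fin -expD exp0 andbT; apply/eqP => D0.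
  have lp1 v : letter_pow Phi D v = 1 by rewrite /letter_pow -D0 powRr0.
  have le1 : level (letter_pow Phi D) 1 <= 1.
    rewrite (le_trans (level_critical_le 1 hd expD ltr01 _)) ?expr1n ?invr1//.
    by move=> v; rewrite lp1.
  have : mass (letter_pow Phi D) [:: [:: a]; [:: letter_inv a]] <= 1.
    apply: le_trans le1; apply: mass_le_subset => // [v|w].
      exact: letter_pow_gt0.
    by rewrite !inE mem_words => /orP[]/eqP->.
  by rewrite /mass /weight !big_cons !big_nil !lp1; lra.
exists D, (k ^+ 4)^-1; split=> // n; last exact: level_critical_le.
rewrite leNgt; apply/negP => /(mass_lt1_left D0)[t /andP[t0 tD] lt1].
have := exponent_le t0 (series_at_lty lt1).
by rewrite expD lee_fin leNgt tD.
Qed.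
(** * A prefix code of products of conjugates *)

(** For a loop g at [a], the words g and g^-1 begin and end with [a] or its
    inverse.  These are the conditions under which g h g^-1 h is reduced and
    can be followed by another word of this form. *)
Definition linker d (a : letter d) h : bool :=
  [&& path (@edge d) a h, path (@edge d) (letter_inv a) h,
      edge (last a h) a & edge (last a h) (letter_inv a)].

(** The second factor [h] separates the end of g^-1 from the beginning of the
    next code word: both g and the next conjugator start with the same letter,
    so without it cancellation would occur. *)
Definition conj_code d (h g : seq (letter d)) := g ++ h ++ word_inv g ++ h.

Lemma conj_code_path d (a : letter d) h n g s :
  linker a h -> (0 < n)%N -> g \in loops a n -> path (@edge d) (last a h) s ->
  path (@edge d) (last a h) (conj_code h g ++ s).
Proof.
case/and4P => ph ph' la la' n0 /(mem_loopsP n0)[_ rg [u eg lu]] ps.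
have hg : head a (word_inv g) = letter_inv a.
  by rewrite eg (lastI a u) lu /word_inv map_rcons rev_rcons.
have h0 x : last x h = last a h.
  by case: (h) la la' => //=; rewrite /edge letter_invK eqxx.
have lig : last (last a h) (word_inv g) = letter_inv a.
  by rewrite eg /word_inv /= rev_cons last_rcons.
have lg x : last x g = a by rewrite eg.
rewrite -!catA !cat_path lg lig (h0 (letter_inv a)) ph ph' ps.
by rewrite !(path_reduced _ a) rg reduced_inv//= hg la' eg /= la !orbT.
Qed.

Lemma weight_conj_code (R : realType) d (f : letter d -> R) h g :
  (forall v, f v = f (letter_inv v)) ->
  weight f (conj_code h g) = weight f g ^+ 2 * weight f h ^+ 2.
Proof. by move=> fs; rewrite !weight_cat weight_inv//; ring. Qed.

(** Induction on the number of word lengths used.  At each step all loops of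
    one new length n, larger than all the code words so far, are added, except
    those beginning with a code word.  The latter weigh at most C times the
    total weight of the code words, and a code word of a conjugator g weighs
    at most [r ^+ size g] times the weight of g; so if all the lengths are at
    least a large [n0] the loss is at most [eta / 2]. *)
Lemma sparse_conj_code (R : realType) d (f : letter d -> R) (a : letter d) h
    (r C eta : R) K :
  (forall v, f v = f (letter_inv v)) ->
  (forall v, 0 < f v <= r) -> r < 1 -> 0 < eta ->
  (forall n, level f n <= C) ->
  (forall n, eta <= mass f (loops a (n + 4))) ->
  exists S, [/\ uniq S, forall g, g \in S -> exists2 n, (0 < n)%N & g \in loops a n,
    {in S &, forall g g', prefix (conj_code h g) (conj_code h g') -> g = g'} &
    K%:R * (eta / 2) <= mass f S].
Proof.
move=> fs fr r1 eta0 levC loopsE.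
have f0 v : 0 < f v by case/andP: (fr v).
have r0 : 0 < r by apply: lt_le_trans (f0 a) _; case/andP: (fr a).
have C0 : 0 <= C by apply: le_trans (levC 0%N); exact: mass_ge0.
have f1 v : 0 < f v <= 1 by rewrite f0 (le_trans _ (ltW r1))//; case/andP: (fr v).
(* [n0] makes the loss acceptable at each of the K steps *)
have [n0 n0P] : exists n0, r ^+ n0 * (K%:R * (C * C)) <= eta / 2.
  have := @cvg_expr R r; rewrite gtr0_norm// => /(_ r1)/cvgr_lt.
  have B0 : 0 < K%:R * (C * C) + 1 by rewrite ltr_wpDl// !mulr_ge0.
  move=> /(_ (eta / 2 / (K%:R * (C * C) + 1))).
  rewrite !divr_gt0// => /(_ isT)[n _ /(_ n (leqnn n))/= rn].
  exists n; move: rn; rewrite ltr_pdivlMr// mulrDr mulr1 => rn.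
  by apply: ltW; apply: le_lt_trans rn; rewrite lerDl exprn_ge0// ltW.
suff: forall k, (k <= K)%N -> exists S, [/\ uniq S,
    forall g, g \in S -> exists2 n, (0 < n)%N & g \in loops a n,
    {in S &, forall g g', prefix (conj_code h g) (conj_code h g') -> g = g'},
    mass f [seq conj_code h g | g <- S] <= k%:R * (r ^+ n0 * C) &
    k%:R * (eta / 2) <= mass f S].
  by move=> /(_ K (leqnn K))[S [? ? ? _ ?]]; exists S.
elim=> [_|k IH kK].
  by exists [::]; split=> //; rewrite /mass !big_nil mul0r.
have [S [uS SL pS massC massS]] := IH (ltnW kK).
(* 4 letters are needed to turn a word into a loop, whence the form of n *)
pose m := (n0 + \max_(g <- S) size (conj_code h g))%N; pose n := (m.+1 + 4)%N.
have codeS g : g \in S -> (size (conj_code h g) < n)%N.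
  move=> gS; rewrite ltn_addr// ltnS; apply: leq_trans (leq_addl _ _).
  exact: leq_bigmax_seq.
have sizeS g : g \in S -> (size g < n)%N.
  by move=> /codeS; apply: leq_ltn_trans; rewrite size_cat leq_addr.
pose bad g' := has (fun g => prefix (conj_code h g) g') S.
pose new := [seq g <- loops a n | ~~ bad g].
have newL g : g \in new -> g \in loops a n by rewrite mem_filter => /andP[].
have sizeN g : g \in new -> size g = n by move=> /newL/mem_loopsP[].
have massB : mass f [seq g <- loops a n | bad g] <= eta / 2.
  pose L := [seq conj_code h g ++ s | g <- S, s <- words d (n - size (conj_code h g))].
  apply: (@le_trans _ _ (mass f L)).
    apply: mass_le_subset => //; first exact/filter_uniq/loops_uniq.
    move=> g'; rewrite mem_filter => /andP[/hasP[g gS /prefixP[s eg']]].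
    move=> /mem_loopsP[//|sg rg _]; apply/allpairsPdep; exists g, s; split=> //.
    rewrite mem_words -sg eg' size_cat addKn eqxx /=.
    by move: rg; rewrite eg' => /reduced_cat/andP[].
  apply: (@le_trans _ _ (mass f [seq conj_code h g | g <- S] * C)).
    rewrite /L /mass big_allpairs_dep big_map mulr_suml ler_sum// => g _.
    under eq_bigr do rewrite weight_cat.
    by rewrite -mulr_sumr; apply: ler_wpM2l; [exact/ltW/weight_gt0|exact: levC].
  apply: le_trans n0P; apply: (@le_trans _ _ (k%:R * (r ^+ n0 * C) * C)).
    exact: ler_wpM2r.
  rewrite [leLHS](_ : _ = r ^+ n0 * (k%:R * (C * C))); last by ring.
  apply: ler_wpM2l; first by rewrite exprn_ge0// ltW.
  by rewrite ler_wpM2r ?mulr_ge0// ler_nat ltnW.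
have massN : eta / 2 <= mass f new.
  have := loopsE m.+1; rewrite -/n (mass_filter f bad) -/new => massL.
  by rewrite -lerBlDl in massL; apply: le_trans massL; lra.
have massCN : mass f [seq conj_code h g | g <- new] <= r ^+ n0 * C.
  apply: (@le_trans _ _ (r ^+ n0 * mass f new)).
    rewrite /mass big_map mulr_sumr !big_seq ler_sum// => g gN.
    have g0 := weight_gt0 g f0; have h0 := weight_gt0 h f0.
    rewrite weight_conj_code// -[leRHS]mulr1; apply: ler_pM.
    - by rewrite exprn_ge0// ltW.
    - by rewrite exprn_ge0// ltW.
    - rewrite expr2 ler_pM2r//; apply: le_trans (weight_le_exp _ fr) _.
      rewrite sizeN// ler_wiXn2l ?ltW//.
      by apply: leq_trans (leq_addr _ _); apply/leqW/leq_addr.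
    - by apply: exprn_ile1; [exact: ltW|exact: weight_le1].
  rewrite ler_wpM2l ?exprn_ge0 ?(ltW r0)//; apply: le_trans (levC n).
  apply: mass_le_subset => // [|g /newL]; first exact/filter_uniq/loops_uniq.
  by rewrite mem_filter => /andP[].
exists (new ++ S); split.
- rewrite cat_uniq uS filter_uniq ?loops_uniq// andbT; apply/hasPn => g gS.
  by apply/negP => /sizeN e; move: (sizeS g gS); rewrite e ltnn.
- by move=> g; rewrite mem_cat => /orP[/newL|/SL//]; exists n.
- move=> g g'; rewrite !mem_cat => /orP[gN|gS] /orP[gN'|gS'].
  + by rewrite prefix_catr ?(sizeN g) ?(sizeN g')// => /andP[/eqP].
  (* the longer code word is not a prefix of the shorter one *)
  + move=> /size_prefix le; have := leq_ltn_trans le (codeS _ gS').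
    by rewrite size_cat (sizeN g)// ltnNge leq_addr.
  (* a shorter code word would fit into the new conjugator g' *)
  + rewrite prefixE takel_cat ?(sizeN g')// 1?ltnW ?codeS// -prefixE => pg.
    by move: gN'; rewrite mem_filter => /andP[/hasPn/(_ g gS)]; rewrite pg.
  + exact: pS.
- rewrite map_cat mass_cat -natr1 mulrDl mul1r addrC; exact: lerD.
- rewrite mass_cat -natr1 mulrDl mul1r addrC; exact: lerD.
Qed.
(** * Normal subgroups *)

Lemma fg_word_mul d (x y : free_group d) :
  reduced (fg_word x ++ fg_word y) -> fg_word (x * y)%g = fg_word x ++ fg_word y.
Proof. exact: word_mul_cat. Qed.

Lemma fg_word_conjV d (x u : free_group d) :
  reduced (fg_word u ++ fg_word x ++ word_inv (fg_word u)) ->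
  fg_word (x ^ u^-1)%g = fg_word u ++ fg_word x ++ word_inv (fg_word u).
Proof.
move=> red; have red' : reduced (fg_word x ++ word_inv (fg_word u)).
  by case/reduced_cat/andP: red.
have xu : fg_word (x * u^-1)%g = fg_word x ++ word_inv (fg_word u).
  exact: (@fg_word_mul _ x u^-1%g).
by rewrite conjgE invgK fg_word_mul xu.
Qed.

(** If v ... l spells a non-trivial element of N, choose b different from the
    inverse of v and from l.  Then b v ... l b^-1 is a reduced conjugate, and any
    letter a other than b and b^-1 is linked by it. *)
Lemma normal_linker d (N : set (free_group d)) : (2 <= d)%N ->
  normal_subgroup N -> N != [set 1%g] ->
  exists a, exists2 h, N h & linker a (fg_word h).
Proof.
move=> hd [[N1 _] Nconj] Nneq.
have [x Nx x1] : exists2 x, N x & x <> 1%g.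
  apply: contrapT => H; move/eqP: Nneq; apply; apply/seteqP; split=> [x Nx|x ->].
    by apply: contrapT => x1; apply: H; exists x.
  by move: N1; rewrite inE.
have [v [w xE]] : exists v w, fg_word x = v :: w.
  case xE: (fg_word x) => [|v w]; last by exists v, w.
  by case: x1; apply: val_inj.
have [b /andP[bv bl]] := exists_letter_notin (letter_inv v) (last v w) hd.
have [a /andP[ab ab']] := exists_letter_notin b (letter_inv b) hd.
pose g : free_group d := @FreeGroup d [:: b] isT.
have red : reduced (fg_word g ++ fg_word x ++ word_inv (fg_word g)).
  have := fg_wordP x; rewrite xE /reduced /= => rx.
  by rewrite /edge bv cat_path rx /= /edge letter_invK eq_sym bl.
exists a, (x ^ g^-1)%g; first exact: Nconj.
rewrite fg_word_conjV// xE; move: red; rewrite xE => red.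
rewrite /linker !(path_reduced _ a) red /= !last_cat /=.
rewrite /edge !letter_invK !(inj_eq (inv_inj (@letter_invK d))).
by apply/and4P; split; rewrite // eq_sym.
Qed.

(** * Strictness *)

Lemma weight_letter_pow_half (R : realType) d (Phi : linear_gdms R d) t w :
  weight (letter_pow Phi (t / 2)) w ^+ 2 = weight (letter_pow Phi t) w.
Proof.
rewrite expr2 /weight -big_split /=; apply: eq_bigr => v _.
have c0 : gdms_ratio Phi v != 0.
  by have /andP[/gt_eqF->] := gdms_ratio_itv Phi v.
by rewrite /letter_pow -powRD ?c0 ?implybT// -splitr.
Qed.

Theorem theorem1p2 (R : realType) (d : nat) (hd : (2 <= d)%N)
    (Phi : linear_gdms R d) (hPhi : symmetric_gdms Phi)
    (N : set (free_group d)) (hN : normal_subgroup N)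
    (hN1 : N != [set 1%g]) :
  (exponent_of_convergence N Phi > exponent_of_convergence setT Phi / 2%:E)%E.
Proof.
have [D [C [D0 expD lev1 levC]]] := critical_exponent Phi hd.
have [a [h Nh lh]] := normal_linker hd hN hN1.
pose f := letter_pow Phi D.
have f0 v : 0 < f v by exact: letter_pow_gt0.
have fs v : f v = f (letter_inv v) by rewrite /f /letter_pow hPhi.
have [r r1 fr] : exists2 r, r < 1 & forall v, 0 < f v <= r.
  have [v _ vmax] := @Order.TotalTheory.arg_maxP _ R _ a xpredT f isT.
  exists (f v) => [|u]; first exact: letter_pow_lt1.
  by rewrite f0; exact: vmax.
have [k k0 fk] : exists2 k, 0 < k & forall v, k <= f v.
  have [v _ vmin] := @Order.TotalTheory.arg_minP _ R _ a xpredT f isT.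
  by exists (f v) => [|u]; [exact: f0|exact: vmin].
have k40 : 0 < k ^+ 4 by exact: exprn_gt0.
have loopsE n : k ^+ 4 <= mass f (loops a (n + 4)).
  apply: le_trans (level_le_loops a n hd k0 fk).
  by rewrite -[leLHS]mulr1 ler_wpM2l ?lev1// ltW.
have h0 : 0 < weight f (fg_word h) by exact: weight_gt0.
(* enough word lengths for the code to have total weight above 1 at D / 2 *)
pose K := (Num.truncn (k ^+ 4 / 2 * weight f (fg_word h))^-1).+1.
have [S [uS SL pS massS]] :=
  sparse_conj_code (fg_word h) K fs fr r1 k40 levC loopsE.
pose T := [seq conj_code (fg_word h) g | g <- S].
have gt1 : 1 < mass (letter_pow Phi (D / 2)) T.
  have -> : mass (letter_pow Phi (D / 2)) T = mass f S * weight f (fg_word h).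
    rewrite /mass big_map mulr_suml; apply: eq_bigr => g _.
    rewrite weight_conj_code ?weight_letter_pow_half// => v.
    by rewrite /letter_pow hPhi.
  apply: lt_le_trans (ler_wpM2r (ltW h0) massS); rewrite -mulrA.
  by rewrite -ltr_pdivrMr ?mulr_gt0 ?divr_gt0// div1r; exact: truncnS_gt.
have [t Dt {}gt1] := mass_gt1_right gt1.
have uT : uniq T.
  by rewrite map_inj_in_uniq// => g g' gS g'S e; apply: pS => //; rewrite e prefix_refl.
have pT : prefix_code T.
  by move=> _ _ /mapP[g gS ->] /mapP[g' g'S ->] /pS ->.
have Nt : series_at Phi N t = +oo%E.
  apply: (code_series_eqy uT pT gt1 (A := fun s =>
    path (@edge d) (last a (fg_word h)) s /\ exists2 x, N x & fg_word x = s)).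
  - split=> //; exists 1%g => //.
    by case: hN => -[+ _] _; rewrite inE.
  - move=> _ s /mapP[g gS ->] [ps [x Nx xs]].
    have [n n0 gL] := SL _ gS.
    have pgs := conj_code_path lh n0 gL ps; split=> //.
    have [_ rg _] := mem_loopsP n0 gL.
    pose G := FreeGroup rg.
    have red := path_sorted pgs; rewrite /conj_code -!catA in red.
    exists ((h ^ G^-1) * (h * x))%g.
      have NM x' y' : N x' -> N y' -> N (x' * y')%g.
        case: hN => [Nsub _]; have := group_closedM Nsub => NM Nx' Ny'.
        by have := NM x' y'; rewrite !inE => /(_ Nx' Ny').
      by apply: (NM); [apply: hN.2|apply: (NM)].
    have redgh : reduced (g ++ fg_word h ++ word_inv g).
      by move: red; rewrite !catA -(catA _ _ s) => /reduced_cat/andP[].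
    have redhs : reduced (fg_word h ++ s).
      by move: red; rewrite !catA -(catA _ _ s) => /reduced_cat/andP[].
    have hx : fg_word (h * x)%g = fg_word h ++ s by rewrite fg_word_mul xs.
    have cx := fg_word_conjV (u := G) redgh.
    by rewrite /conj_code fg_word_mul cx hx -!catA.
  - by move=> s [].
rewrite expD inver pnatr_eq0 /= -EFinM.
by apply: lt_le_trans (exponent_ge Nt); rewrite lte_fin.
Qed.
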